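(* There exists a universal constant $A>0$ such that for any probability measure $\mu$ on $\mathbb{R}$ with finite moments, any $x^*\in \mathbb{R}$, any $\alpha>0$, any bounded function $f:\mathbb{R}\to\mathbb{R}$, any $\varepsilon>0$, any $N\in \mathbb{R}\setminus\{0\}$ and any $n\in \mathbb{N}$, $$P\left(\frac{1}{N} \left| X_{f,\alpha,x^*}^{(n)}-\mathbb{E} X_{f,\alpha,x^*}^{(n)} \right|\geq \varepsilon \right)\leq 2 \exp \left(- \varepsilon \min \left( \frac{ \varepsilon N^2}{ 8A n \|f\|_\infty^2 }, \frac{N}{6\|f\|_\infty} \right) \right).$$
   Context: Let $\mu$ be a probability measure on $\mathbb{R}$ with finite moments (and infinite support). The orthogonal polynomial ensemble (OPE) of size $n$ associated with $\mu$ is the probability measure on $\mathbb{R}^n$ $$\frac{1}{Z_n}\prod_{i>j}(\lambda_i-\lambda_j)^2\,d\mu(\lambda_1)\cdots d\mu(\lambda_n),$$ with $Z_n$ a normalizing constant. For $f:\mathbb{R}\to\mathbb{R}$ (Borel measurable), $\alpha>0$ and $x^*\in\mathbb{R}$, the scaled linear statistic is $X_{f,\alpha,x^*}^{(n)}=\sum_{j=1}^n f\big(n^\alpha(\lambda_j-x^* )\big)$ with $(\lambda_1,\dots,\lambda_n)$ random from the OPE; $P$ and $\mathbb{E}$ refer to this measure. $\|f\|_\infty$ is the supremum norm of $f$ (the case $f=0$, in which the left-hand side is trivial, may be excluded). *)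

(* Defs.v *)
Set Warnings "-notation-overridden,-notation-incompatible-prefix,-ambiguous-paths,-redundant-canonical-projection".
From HB Require Import structures.
From mathcomp Require Import all_boot all_order all_algebra.
From mathcomp Require Import all_classical all_reals all_analysis measurable_realfun.

Set Implicit Arguments.
Unset Strict Implicit.
Unset Printing Implicit Defensive.

Import Order.TTheory GRing.Theory Num.Theory.
Import numFieldNormedType.Exports.

Local Open Scope classical_set_scope.
Local Open Scope ring_scope.

Section product_power.
Context d (T : measurableType d) (R : realType).

Definition tuple_cons n (p : T * n.-tuple T) : n.+1.-tuple T :=
  [the n.+1.-tuple T of p.1 :: p.2].

Lemma measurable_tuple_cons n : measurable_fun [set: T * n.-tuple T] (@tuple_cons n).
Proof. exact: (measurable_cons measurable_fst measurable_snd). Qed.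

HB.instance Definition _ n :=
  isMeasurableFun.Build _ _ _ _ (@tuple_cons n) (@measurable_tuple_cons n).

Fixpoint product_power (mu : probability T R) n : probability (n.-tuple T) R :=
  match n with
  | 0 => \d_ ([tuple] : 0.-tuple T)
  | m.+1 => distribution (mu \x product_power mu m)%E (@tuple_cons m)
  end.

End product_power.

Section density_measure.
Local Open Scope ereal_scope.
Context d (T : measurableType d) (R : realType) (mu : {measure set T -> \bar R}).
Variable f : T -> R.
Hypotheses (mf : measurable_fun [set: T] f) (f0 : forall x, (0 <= f x)%R).

Definition density_measure of measurable_fun [set: T] f & (forall x, (0 <= f x)%R) :=
  fun A : set T => \int[mu]_(x in A) (f x)%:E.

Local Notation nu := (density_measure mf f0).

Let nu0 : nu set0 = 0. Proof. exact: integral_set0. Qed.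

Let nu_ge0 A : 0 <= nu A.
Proof. by apply: integral_ge0 => x _; rewrite lee_fin. Qed.

Let nu_sigma_additive : semi_sigma_additive nu.
Proof.
apply: semi_sigma_additive_nng_induced => [|x]; last by rewrite lee_fin.
exact/measurable_EFinP.
Qed.

HB.instance Definition _ := isMeasure.Build _ _ _ nu nu0 nu_ge0 nu_sigma_additive.

End density_measure.

Section orthogonal_polynomial_ensemble.
Variable R : realType.
Local Notation RM := (measurableTypeR R).

Definition vandermonde_sq n (l : n.-tuple RM) : R :=
  \prod_(i < n) \prod_(j < n | (j < i)%N) (tnth l i - tnth l j) ^+ 2.

Lemma vandermonde_sq_ge0 n (l : n.-tuple RM) : 0 <= vandermonde_sq l.
Proof. by apply: prodr_ge0 => i _; apply: prodr_ge0 => j _; exact: sqr_ge0. Qed.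

Lemma measurable_vandermonde_sq n :
  measurable_fun [set: n.-tuple RM] (@vandermonde_sq n).
Proof.
rewrite (_ : @vandermonde_sq n = fun l : n.-tuple RM => \prod_(i < n) \prod_(j < n)
    if (j < i)%N then (tnth l i - tnth l j) ^+ 2 else 1); last first.
  by apply/funext => l; apply: eq_bigr => i _; rewrite big_mkcond.
apply: measurable_prod => i _; apply: measurable_prod => j _.
case: (ltnP j i) => _; last exact: measurable_cst.
by apply: measurable_funX; apply: measurable_funB; exact: measurable_tnth.
Qed.

(* When 0 < Z_n < +oo, where Z_n is the total mass of [density_measure],
   [mnormalize] divides by Z_n; this is the case as soon as mu has finite
   moments and infinite support. The last argument of [mnormalize] is the value
   taken when Z_n is 0 or +oo. *)
Definition ope (mu : probability RM R) n : probability (n.-tuple RM) R :=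
  mnormalize (density_measure (product_power mu n)
                (@measurable_vandermonde_sq n) (@vandermonde_sq_ge0 n))
    (product_power mu n).

Definition finite_moments (mu : probability RM R) :=
  forall k : nat, mu.-integrable [set: RM] (fun x : RM => ((x : R) ^+ k)%:E).

Definition msupport (mu : probability RM R) : set R :=
  [set x | forall U : set R, open U -> U x -> (0 < mu U)%E].

Definition linear_statistic (f : R -> R) (alpha xstar : R) n
    (l : n.-tuple RM) : R :=
  \sum_(j < n) f (n%:R `^ alpha * (tnth l j - xstar)).

Definition sup_norm (f : R -> R) : R := sup (range (fun x => `|f x|)).

End orthogonal_polynomial_ensemble.

(* Main.v *)
(** Give the product measure the weights h(l_1)...h(l_n) times the squared
    Vandermonde determinant. Its mass is n! D_n(h), with D_n(h) the Hankel
    determinant of the moments of h mu, and fixing one particle at x turns h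
    into h_x(y) = h(y) (y - x)^2 and n + 1 into n. The ratio
    D_n(h_x) / D_(n+1)(h) is the Christoffel-Darboux kernel v^T H^-1 v at x
    (H the Hankel matrix, v = (x^i)), hence decreasing in h: if |f| <= F,
    replacing h by h e^f changes it by a factor in [e^-F, e^F] only. So the
    Laplace transform of the linear statistic conditioned on one particle is
    within e^F of the unconditioned one, and an induction on n bounds
    E e^(tX) E e^(-tX) by exp(16 n t^2 F^2). By Jensen this also bounds
    E e^(t(X - EX)), and Chernoff's inequality gives the sub-Gaussian tail
    2 exp(-s^2 / (64 n F^2)), i.e. A = 8. *)

Require Import Defs.
Set Warnings "-notation-overridden,-notation-incompatible-prefix,-ambiguous-paths,-redundant-canonical-projection".
From HB Require Import structures.
From mathcomp Require Import all_boot all_order all_algebra.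
From mathcomp Require Import finmap ring lra.
From mathcomp Require Import all_classical all_reals all_analysis measurable_realfun.

Set Implicit Arguments.
Unset Strict Implicit.
Unset Printing Implicit Defensive.

Import Order.TTheory GRing.Theory Num.Theory.
Import numFieldNormedType.Exports.

Local Open Scope classical_set_scope.
Local Open Scope ring_scope.

(** * Quadratic forms and monotonicity of the matrix inverse *)

Section quadratic_forms.
Variable R : realFieldType.

Definition qform n (H : 'M[R]_n) (u : 'rV[R]_n) : R := (u *m H *m u^T) 0 0.

Definition posdef n (H : 'M[R]_n) := forall u, u != 0 -> 0 < qform H u.

Lemma qformE n (H : 'M[R]_n) u :
  qform H u = \sum_i \sum_j H i j * (u 0 i * u 0 j).
Proof.
rewrite /qform mxE [RHS]exchange_big; apply: eq_bigr => j _.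
by rewrite !mxE big_distrl; apply: eq_bigr => i _ /=; ring.
Qed.

Lemma qform0 n (H : 'M[R]_n) : qform H 0 = 0.
Proof. by rewrite /qform !mul0mx mxE. Qed.

Lemma qformZl n c (H : 'M[R]_n) u : qform (c *: H) u = c * qform H u.
Proof. by rewrite /qform -scalemxAr -scalemxAl mxE. Qed.

Lemma posdef_ge0 n (H : 'M[R]_n) u : posdef H -> 0 <= qform H u.
Proof.
move=> pH; have [->|/pH/ltW//] := eqVneq u 0.
by rewrite qform0.
Qed.

Lemma posdef_unit n (H : 'M[R]_n) : posdef H -> H \in unitmx.
Proof.
move=> pH; rewrite unitmxE unitfE; apply/negP => /det0P[u u0 uH].
by have := pH _ u0; rewrite /qform uH mul0mx mxE ltxx.
Qed.

(** Completing the square. For positive definite [H] it shows that [qform (invmx H) v] is the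
    maximum over [u] of [2 * (u *m v^T) 0 0 - qform H u]. *)
Lemma qform_variational n (H : 'M[R]_n) (u v : 'rV_n) :
  H^T = H -> H \in unitmx ->
  qform H (u - v *m invmx H) =
  qform H u - 2 * (u *m v^T) 0 0 + qform (invmx H) v.
Proof.
move=> symH uH; have symV : (invmx H)^T = invmx H by rewrite trmx_inv symH.
rewrite /qform linearB/= mulmxBl !mulmxBr trmx_mul symV !mulmxBl.
rewrite !mulmxA !(mulmxKV uH) mulmxK//.
have -> : v *m u^T = u *m v^T.
  by apply/matrixP => i j; rewrite !ord1 !mxE; apply: eq_bigr => k _; rewrite !mxE mulrC.
rewrite !mxE; ring.
Qed.

(** The maximum given by [qform_variational] can only drop when the form grows. It is enough to
    compare at [u = v *m invmx H'], the maximizer for [H'], where the completed square vanishes. *)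
Lemma qform_invmx_anti n (H H' : 'M[R]_n) v :
  H^T = H -> H'^T = H' -> posdef H -> posdef H' ->
  (forall u, qform H u <= qform H' u) ->
  qform (invmx H') v <= qform (invmx H) v.
Proof.
move=> symH symH' pH pH' HH'; set u := v *m invmx H'.
have := qform_variational u v symH (posdef_unit pH).
have := qform_variational u v symH' (posdef_unit pH').
have := posdef_ge0 (u - v *m invmx H) pH; have := HH' u.
rewrite {4}/u subrr qform0; lra.
Qed.

Lemma qform_invmx_gt0 n (H : 'M[R]_n) v :
  H^T = H -> posdef H -> v != 0 -> 0 < qform (invmx H) v.
Proof.
move=> symH pH v0; have uH := posdef_unit pH.
have -> : qform (invmx H) v = qform H (v *m invmx H).
  by rewrite /qform trmx_mul trmx_inv symH mulmxKV// mulmxA.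
apply: (pH); apply: contra_neq v0 => vH.
by rewrite -(mulmxKV uH v) vH mul0mx.
Qed.

(** This is the trace of [invmx H *m H]; for a Hankel matrix of moments it becomes the integral of
    the kernel. *)
Lemma sum_invmx_sym n (H : 'M[R]_n) : H^T = H -> H \in unitmx ->
  \sum_i \sum_j invmx H i j * H i j = n%:R.
Proof.
move=> symH uH; rewrite -(mxtrace1 R n) -(mulVmx uH) /mxtrace.
apply: eq_bigr => i _; rewrite [RHS]mxE; apply: eq_bigr => j _.
by congr (_ * _); rewrite -[in LHS]symH mxE.
Qed.

End quadratic_forms.

(** * Hankel matrices and the Christoffel-Darboux kernel *)

Section hankel.
Variable R : realFieldType.
Implicit Types (s : nat -> R) (x : R).

Definition hankel n s : 'M[R]_n := \matrix_(i, j) s (i + j)%N.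

(** When [s] is the moment sequence of a measure, this is the sum of the squares at [x] of the
    orthonormal polynomials of degree below [n]; the inverse Hankel matrix avoids constructing
    them. *)
Definition christoffel n s x : R := qform (invmx (hankel n s)) (\row_i x ^+ i).

Lemma tr_hankel n s : (hankel n s)^T = hankel n s.
Proof. by apply/matrixP => i j; rewrite !mxE addnC. Qed.

Lemma hankelZ n c s : hankel n (fun k => c * s k) = c *: hankel n s.
Proof. by apply/matrixP => i j; rewrite !mxE. Qed.

(* The unipotent matrix T subtracts x times each row from the next one: it maps
   the vector (x^i) to e_0, and the lower right block of T H T^T is the Hankel
   matrix of the shifted moments. *)
Lemma det_hankel_shift n s x : hankel n.+1 s \in unitmx ->
  \det (hankel n (fun k => s k.+2 - 2 * x * s k.+1 + x ^+ 2 * s k)) =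
  \det (hankel n.+1 s) * christoffel n.+1 s x.
Proof.
set H := hankel n.+1 s => uH.
pose T : 'M[R]_n.+1 := \matrix_(i, j) ((i == j)%:R - x * (i == j.+1 :> nat)%:R).
have detT : \det T = 1.
  rewrite det_trig.
    by rewrite big1// => i _; rewrite mxE eqxx /= ltn_eqF// mulr0 subr0.
  apply/is_trig_mxP => i j ij; rewrite mxE.
  by rewrite -val_eqE /= !ltn_eqF ?mulr0 ?subr0// ltnW.
pose H' := T *m H *m T^T.
have detH' : \det H' = \det H by rewrite !det_mulmx det_tr detT mul1r mulr1.
have uH' : H' \in unitmx by rewrite !unitmxE detH' -unitmxE.
have Tlift m (M : 'M[R]_(n.+1, m)) (i : 'I_n) j :
    (T *m M) (lift ord0 i) j = M (lift ord0 i) j - x * M (widen_ord (leqnSn n) i) j.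
  rewrite mxE (bigD1 (lift ord0 i))//= (bigD1 (widen_ord (leqnSn n) i))/=; last first.
    by rewrite -val_eqE /= /bump add1n ltn_eqF.
  rewrite big1 => [|k /andP[k1 k2]].
    rewrite !mxE eqxx -!val_eqE /= /bump add1n eqxx (ltn_eqF (ltnSn i.+1)) (gtn_eqF (ltnSn i)).
    by rewrite /=; ring.
  rewrite !mxE (negbTE _ : (lift ord0 i == k) = false) 1?eq_sym//.
  rewrite (_ : _ == _ = false) ?mulr0 ?subrr ?mul0r//.
  apply: contraNF k2; rewrite /= /bump add1n eqSS => /eqP ik.
  by apply/eqP/val_inj.
have blockE : row' 0 (col' 0 H') =
    hankel n (fun k => s k.+2 - 2 * x * s k.+1 + x ^+ 2 * s k).
  have H'E : H' = (T *m (T *m H)^T)^T by rewrite trmx_mul trmxK.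
  apply/matrixP => i j; rewrite mxE [LHS]mxE H'E mxE Tlift.
  rewrite [_^T _ _]mxE [_^T (widen_ord _ _) _]mxE !Tlift !mxE /= /bump !add1n.
  by rewrite !addnS !addSn; ring.
have vT : (\row_i x ^+ i) *m T^T = delta_mx 0 0 :> 'rV[R]_n.+1.
  rewrite -[LHS]trmxK trmx_mul trmxK; apply/matrixP => k j; rewrite ord1 mxE.
  case: (unliftP ord0 j) => [i ->|->]; first by rewrite Tlift !mxE /= exprS subrr.
  rewrite mxE big_ord_recl big1 => [|i _]; rewrite !mxE/= ?mulr0 ?subr0 ?mulr1 ?addr0//.
  by rewrite mul0r.
(* Solving [H' = T *m H *m T^T] for the inverse of [H] turns the kernel at [x] into a single entry
   of the inverse of [H']. *)
have HV : T^T *m invmx H' *m T = invmx H.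
  rewrite -[LHS](mulmxK uH); suff -> : T^T *m invmx H' *m T *m H = 1%:M by rewrite mul1mx.
  have uTt : T^T \in unitmx by rewrite unitmx_tr unitmxE detT unitr1.
  rewrite -[LHS](mulmxK uTt) -!mulmxA (mulmxA T H) (mulmxA (T *m H)) -/H'.
  by rewrite (mulmxA (invmx H')) mulVmx// mul1mx mulmxV.
have -> : christoffel n.+1 s x = invmx H' 0 0.
  rewrite /christoffel /qform -HV !mulmxA vT -!mulmxA -[T *m _]trmxK trmx_mul trmxK vT.
  by rewrite trmx_delta -rowE -colE !mxE.
(* By the adjugate formula, that entry is the complementary minor, i.e. the shifted Hankel
   determinant, over the determinant of [H]. *)
rewrite -blockE /invmx uH' mxE detH' mulrA divff ?mul1r; last by rewrite -unitfE -unitmxE.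
by rewrite mxE /cofactor expr0 mul1r.
Qed.

Lemma christoffel_anti n s s' x :
  posdef (hankel n s) -> posdef (hankel n s') ->
  (forall u, qform (hankel n s) u <= qform (hankel n s') u) ->
  christoffel n s' x <= christoffel n s x.
Proof. by move=> ps ps' ss'; apply: qform_invmx_anti => //; exact: tr_hankel. Qed.

Lemma christoffel_gt0 n s x : posdef (hankel n.+1 s) -> 0 < christoffel n.+1 s x.
Proof.
move=> ps; apply: qform_invmx_gt0 => //; first exact: tr_hankel.
apply/eqP => /rowP/(_ 0); rewrite !mxE expr0; exact/eqP/oner_neq0.
Qed.

Lemma christoffelZ n c s x : c != 0 -> hankel n s \in unitmx ->
  christoffel n (fun k => c * s k) x = c^-1 * christoffel n s x.
Proof. by move=> c0 us; rewrite /christoffel hankelZ invmxZ ?qformZl// unitmxZ ?unitfE. Qed.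

End hankel.

(** * Elementary inequalities behind the quadratic exponent *)

Lemma expR_le_quad (R : realType) (u : R) : expR u <= u + expR (2 * u ^+ 2).
Proof.
(* From [1/2] on, [u <= 2 u^2]. Below it, [expR u <= 1/(1 - u)] suffices, since [(1 - u)(1 + u + 2
   u^2) = 1 + u^2 (1 - 2 u) >= 1]. *)
have [u2|u2] := leP 2^-1 u.
  have : expR u <= expR (2 * u ^+ 2) by rewrite ler_expR; nra.
  by lra.
have E1 := expR_ge1Dx (2 * u ^+ 2).
suff : expR u <= 1 + u + 2 * u ^+ 2 by lra.
have u1 : 0 < 1 - u by lra.
have : expR u <= (1 - u)^-1.
  by rewrite -[expR u]invrK -expRN lef_pV2 ?posrE ?expR_gt0//; exact: expR_ge1Dx.
move/le_trans; apply; rewrite -[leLHS]mul1r ler_pdivrMr//.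
nra.
Qed.

(** The linear terms of [expR_le_quad] at [u] and [- u] cancel; with [y = expR (2 * u ^+ 2)] there
    remains [2 y - 1 <= y^2]. *)
Lemma expR_addN_le (R : realType) (u : R) :
  expR u + expR (- u) - 1 <= expR (4 * u ^+ 2).
Proof.
have := expR_le_quad u; have := expR_le_quad (- u); rewrite sqrrN.
have -> : 4 * u ^+ 2 = 2 * u ^+ 2 + 2 * u ^+ 2 by ring.
rewrite expRD; set y := expR (2 * _); have := sqr_ge0 (y - 1); nra.
Qed.

(** The convex function [w + w^-1] takes the same value at both ends of the interval. *)
Lemma addV_le (R : realFieldType) (E w : R) : 0 < E -> E^-1 <= w -> w <= E ->
  w + w^-1 <= E + E^-1.
Proof.
move=> E0 Ew wE; have w0 : 0 < w by apply: lt_le_trans Ew; rewrite invr_gt0.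
have Ew1 : 1 <= E * w by rewrite -ler_pdivrMl// mulr1.
rewrite -subr_ge0 (_ : _ - _ = (E - w) * (E * w - 1) / (E * w)); last by field; lra.
by rewrite divr_ge0// mulr_ge0; lra.
Qed.

(** * Weights, their moments, and the shift and tilt operations *)

Section weights.
Variables (R : realType) (mu : probability (measurableTypeR R) R).
Local Notation RM := (measurableTypeR R).
Implicit Types (h f : RM -> R) (x c F : R) (p : {poly R}).

Definition integrable_moments h :=
  forall k, mu.-integrable setT (fun x : RM => (h x * (x : R) ^+ k)%:E).

Definition moment h k : R := \int[mu]_x (h x * (x : R) ^+ k).

(** [weight_pos] makes every Hankel matrix of moments of [h] positive definite. All four conditions
    survive shifts and bounded tilts, so the induction on the number of particles stays within this
    class. *)
Record weight h : Prop := Weight {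
  weight_meas : measurable_fun setT h;
  weight_ge0 : forall x, 0 <= h x;
  weight_int : integrable_moments h;
  weight_pos : forall p, p != 0 -> 0 < \int[mu]_x (h x * p.[x] ^+ 2) }.

Definition shift_weight h c : RM -> R := fun x => h x * (x - c) ^+ 2.

Definition tilt h f : RM -> R := fun x => h x * expR (f x).

(** The exponents are arbitrary so that the same statement serves polynomials, double sums and the
    expansion of [(x - c)^2]. *)
Lemma moment_sum I (r : seq I) (c : I -> R) (k : I -> nat) h :
  integrable_moments h ->
  mu.-integrable setT (fun x : RM => (h x * \sum_(i <- r) c i * (x : R) ^+ k i)%:E) /\
  \int[mu]_x (h x * \sum_(i <- r) c i * (x : R) ^+ k i) =
  \sum_(i <- r) c i * moment h (k i).
Proof.
move=> hi; elim: r => [|a r [IH1 IH2]].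
  rewrite big_nil; split.
    under eq_fun do rewrite big_nil mulr0; exact: integrable0.
  under eq_Rintegral do rewrite big_nil mulr0.
  by rewrite /Rintegral integral0.
have E x : h x * \sum_(i <- a :: r) c i * x ^+ k i =
    c a * (h x * x ^+ k a) + h x * \sum_(i <- r) c i * x ^+ k i.
  by rewrite big_cons mulrDr mulrCA.
have i1 : mu.-integrable setT (fun x : RM => (c a * (h x * (x : R) ^+ k a))%:E).
  by have := integrableZl measurableT (c a) (hi (k a)).
split; first by under eq_fun do rewrite E EFinD; exact: integrableD.
under eq_Rintegral do rewrite E.
by rewrite RintegralD// IH2 RintegralZl ?big_cons//; exact: hi.
Qed.

Lemma moment_sum2 (m n : nat) (c : 'I_m -> 'I_n -> R) h :
  integrable_moments h ->
  mu.-integrable setT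
    (fun x : RM => (h x * \sum_i \sum_j c i j * (x : R) ^+ (i + j))%:E) /\
  \int[mu]_x (h x * \sum_i \sum_j c i j * (x : R) ^+ (i + j)) =
  \sum_i \sum_j c i j * moment h (i + j).
Proof.
move=> hi.
have [] := moment_sum (index_enum _) (fun u : 'I_m * 'I_n => c u.1 u.2)
  (fun u => u.1 + u.2)%N hi.
under eq_fun do rewrite -(pair_bigA _ (fun i j => c i j * _ ^+ (i + j)))/=.
under eq_Rintegral do rewrite -(pair_bigA _ (fun i j => c i j * _ ^+ (i + j)))/=.
by rewrite -(pair_bigA _ (fun i j => c i j * moment h (i + j)))/=.
Qed.

Lemma integrable_horner h p : integrable_moments h ->
  mu.-integrable setT (fun x : RM => (h x * p.[x])%:E).
Proof.
move=> hi.
have [+ _] := moment_sum (index_enum _) (fun i : 'I_(size p) => p`_i) (@nat_of_ord _) hi.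
by under eq_fun do rewrite -horner_coef.
Qed.



(** The square of the polynomial with coefficients [u] expands into the double sum. This identity
    turns pointwise comparison of weights into comparison of Hankel forms. *)
Lemma qform_moment n h (u : 'rV[R]_n) : integrable_moments h ->
  qform (hankel n (moment h)) u = \int[mu]_x (h x * (rVpoly u).[x] ^+ 2).
Proof.
move=> hi; rewrite qformE.
have [_ E] := moment_sum2 (fun i j : 'I_n => u 0 i * u 0 j) hi.
transitivity (\sum_i \sum_j u 0 i * u 0 j * moment h (i + j)).
  by apply: eq_bigr => i _; apply: eq_bigr => j _; rewrite mxE mulrC.
rewrite -E; apply: eq_Rintegral => x _; congr (_ * _).
rewrite (@horner_coef_wide _ n) ?size_poly// expr2 big_distrlr/=.
apply: eq_bigr => i _; apply: eq_bigr => j _.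
by rewrite !coef_rVpoly_ord exprD; ring.
Qed.

Lemma integrable_horner_sqr h p : integrable_moments h ->
  mu.-integrable setT (fun x : RM => (h x * p.[x] ^+ 2)%:E).
Proof.
by move=> hi; under eq_fun do rewrite -horner_exp; exact: integrable_horner.
Qed.

Lemma posdef_moment n h : weight h -> posdef (hankel n (moment h)).
Proof.
move=> hw u u0; rewrite qform_moment; last exact: weight_int.
apply: weight_pos => //; apply: contra_neq u0 => pu0.
by rewrite -[u]rVpolyK pu0 linear0.
Qed.

Lemma shift_moment h c : integrable_moments h ->
  integrable_moments (shift_weight h c) /\
  moment (shift_weight h c) =
  (fun k => moment h k.+2 - 2 * c * moment h k.+1 + c ^+ 2 * moment h k).
Proof.
move=> hi.
pose r k : seq (R * nat) := [:: (1, k.+2); (- (2 * c), k.+1); (c ^+ 2, k)].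
have E k x : shift_weight h c x * x ^+ k = h x * \sum_(i <- r k) i.1 * x ^+ i.2.
  by rewrite /r !big_cons big_nil/= /shift_weight !exprS; ring.
split=> [k|].
  have [+ _] := moment_sum (r k) fst snd hi.
  by under eq_fun do rewrite -E.
apply/funext => k; have [_] := moment_sum (r k) fst snd hi.
under eq_Rintegral do rewrite -E.
by rewrite -/(moment _ _) => ->; rewrite /r !big_cons big_nil/=; ring.
Qed.

Lemma weight_shift h c : weight h -> weight (shift_weight h c).
Proof.
move=> [hm h0 hi hp]; split.
- apply: measurable_funM => //; apply: measurable_funX; exact: measurable_funB.
- by move=> x; rewrite mulr_ge0// sqr_ge0.
- by have [] := shift_moment c hi.
(* The factor [(x - c)^2] is absorbed into the square of a polynomial that is still nonzero. *)
- move=> p p0; have := hp (('X - c%:P) * p).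
  rewrite mulf_neq0 ?polyXsubC_eq0// => /(_ isT).
  by under eq_Rintegral do rewrite hornerM hornerXsubC exprMn mulrA.
Qed.

Lemma le_tilt h f F x : 0 <= h x -> `|f x| <= F -> expR (- F) * h x <= tilt h f x <= expR F * h x.
Proof.
move=> h0; rewrite ler_norml /tilt mulrC => /andP[f1 f2].
by rewrite (mulrC (expR F)) !ler_wpM2l// ler_expR.
Qed.

(** Of the two bounds in [le_tilt], the upper one dominates the moments and the lower one preserves
    positivity. *)
Lemma weight_tilt h f F : measurable_fun setT f -> (forall x, `|f x| <= F) ->
  weight h -> weight (tilt h f).
Proof.
move=> fm fF [hm h0 hi hp].
have tm : measurable_fun setT (tilt h f).
  by apply: measurable_funM => //; apply: measurableT_comp.
have ti : integrable_moments (tilt h f).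
  move=> k; apply: (@le_integrable _ _ _ mu _ measurableT _
    (fun x : RM => ((expR F)%:E * (h x * (x : R) ^+ k)%:E)%E)) => //.
  - apply/measurable_EFinP; apply: measurable_funM => //; exact: measurable_funX.
  - move=> x _ /=; rewrite lee_fin mulrA !normrM ler_wpM2r// ?normr_ge0//.
    have /andP[_] := le_tilt (h0 x) (fF x).
    by rewrite -normrM !ger0_norm// mulr_ge0 ?expR_ge0.
  - exact: integrableZl.
split=> //.
- by move=> x; rewrite mulr_ge0 ?expR_ge0.
- move=> p /hp p0; apply: (@lt_le_trans _ _ (expR (- F) * \int[mu]_x (h x * p.[x] ^+ 2))).
    by rewrite mulr_gt0 ?expR_gt0.
  rewrite -RintegralZl//; last exact: integrable_horner_sqr.
  apply: le_Rintegral => //.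
  + by have := integrableZl measurableT (expR (- F)) (integrable_horner_sqr p hi).
  + exact: integrable_horner_sqr.
  + move=> x _; rewrite mulrA ler_wpM2r ?sqr_ge0//.
    by have /andP[] := le_tilt (h0 x) (fF x).
Qed.

(** * Hankel determinants of weights and their change under a bounded tilt *)

Definition hankel_det n h : R := \det (hankel n (moment h)).

Local Notation cd n h := (christoffel n (moment h)).

Lemma hankel_det_shift n h x : weight h ->
  hankel_det n (shift_weight h x) = hankel_det n.+1 h * cd n.+1 h x.
Proof.
move=> hw; rewrite /hankel_det (shift_moment x (weight_int hw)).2.
by apply: det_hankel_shift; exact/posdef_unit/posdef_moment.
Qed.

(** By [hankel_det_shift], the determinant of size [n] of a shifted weight is that of size [n.+1] of
    [h] times a positive kernel. The shift point 0 is an arbitrary choice. *)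
Lemma hankel_det_gt0 n h : weight h -> 0 < hankel_det n h.
Proof.
elim: n h => [|n IH] h hw; first by rewrite /hankel_det det_mx00.
have := IH _ (weight_shift 0 hw); rewrite hankel_det_shift//.
by rewrite pmulr_lgt0//; exact/christoffel_gt0/posdef_moment.
Qed.

(** The weight [expR (- F) * tilt h f] lies below [h], and the kernel is antitone and homogeneous of
    degree -1 in the weight. *)
Lemma christoffel_tilt n h f F x : measurable_fun setT f ->
  (forall x, `|f x| <= F) -> weight h ->
  cd n h x <= expR F * cd n (tilt h f) x.
Proof.
move=> fm fF hw; have tw := weight_tilt fm fF hw.
have e0 : expR F != 0 by rewrite gt_eqF ?expR_gt0.
have ut := posdef_unit (posdef_moment (n:=n) tw).
rewrite -[X in X * _]invrK -christoffelZ ?invr_eq0//; apply: christoffel_anti.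
- by move=> u u0; rewrite hankelZ qformZl mulr_gt0 ?invr_gt0 ?expR_gt0// posdef_moment.
- exact: posdef_moment.
move=> u; rewrite hankelZ qformZl !qform_moment; [|exact: weight_int..].
rewrite ler_pdivrMl ?expR_gt0//.
rewrite -RintegralZl//; last exact/integrable_horner_sqr/weight_int.
apply: le_Rintegral => //.
- exact/integrable_horner_sqr/weight_int.
- by have := integrableZl measurableT (expR F)
    (integrable_horner_sqr (rVpoly u) (weight_int hw)).
- move=> y _; rewrite mulrA ler_wpM2r ?sqr_ge0//.
  by have /andP[] := le_tilt (weight_ge0 hw y) (fF y).
Qed.

Lemma tiltK h f : tilt (tilt h f) (fun x => - f x) = h.
Proof. by apply/funext => x; rewrite /tilt -mulrA -expRD subrr expR0 mulr1. Qed.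

Lemma shift_tilt h f x : shift_weight (tilt h f) x = tilt (shift_weight h x) f.
Proof. by apply/funext => y; rewrite /shift_weight /tilt mulrAC. Qed.

(** Tilting back by [- f] exchanges the roles of the two weights in [christoffel_tilt]. *)
Lemma christoffel_tilt_le n h f F x : measurable_fun setT f ->
  (forall x, `|f x| <= F) -> weight h ->
  cd n (tilt h f) x <= expR F * cd n h x.
Proof.
move=> fm fF hw; rewrite -[in leRHS](tiltK h f); apply: christoffel_tilt.
- exact: measurable_funN.
- by move=> y; rewrite normrN.
- exact: weight_tilt fF hw.
Qed.

(** Integrating out one particle: the shifted determinant is [hankel_det n.+1 h] times the kernel,
    whose integral against [h] is the trace of the identity of size [n.+1]. *)
Lemma hankel_det_rec n h : weight h ->
  mu.-integrable setT (fun x : RM => (h x * hankel_det n (shift_weight h x))%:E) /\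
  \int[mu]_x (h x * hankel_det n (shift_weight h x)) = n.+1%:R * hankel_det n.+1 h.
Proof.
move=> hw; set H := hankel n.+1 (moment h).
have E x : h x * hankel_det n (shift_weight h x) =
   h x * \sum_i \sum_j (hankel_det n.+1 h * invmx H i j) * x ^+ (i + j).
  rewrite hankel_det_shift// /christoffel qformE; congr (_ * _).
  rewrite big_distrr/=; apply: eq_bigr => i _; rewrite big_distrr/=. apply: eq_bigr => j _.
  by rewrite -mulrA; congr (_ * (_ * _)); rewrite !mxE exprD.
have [i1 i2] := moment_sum2 (fun i j : 'I_n.+1 => hankel_det n.+1 h * invmx H i j) (weight_int hw).
split; first by under eq_fun do rewrite E.
under eq_Rintegral do rewrite E.
rewrite i2 -(@sum_invmx_sym _ _ H) ?tr_hankel//; last exact/posdef_unit/posdef_moment.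
rewrite big_distrl/=; apply: eq_bigr => i _; rewrite big_distrl/=; apply: eq_bigr => j _ /=.
by rewrite [in RHS]mxE; ring.
Qed.


(** By [hankel_det_shift] each ratio of a shifted determinant to an unshifted one is a kernel; these
    are the two kernel bounds, cross-multiplied. *)
Lemma hankel_det_tilt n h f F x (D := hankel_det) :
  measurable_fun setT f -> (forall x, `|f x| <= F) -> weight h ->
  expR (- F) * (D n (shift_weight h x) * D n.+1 (tilt h f)) <=
    D n (shift_weight (tilt h f) x) * D n.+1 h <=
    expR F * (D n (shift_weight h x) * D n.+1 (tilt h f)).
Proof.
move=> fm fF hw; have tw := weight_tilt fm fF hw.
rewrite /D !hankel_det_shift//.
have d0 := hankel_det_gt0 n.+1 hw; have d1 := hankel_det_gt0 n.+1 tw.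
have := christoffel_tilt n.+1 x fm fF hw.
have := christoffel_tilt_le n.+1 x fm fF hw.
set q := cd _ h x; set q' := cd _ _ x => q1 q2.
set a := hankel_det _ _ in d0 *; set b := hankel_det _ _ in d1 *.
have ab : 0 < a * b by rewrite mulr_gt0.
rewrite (_ : expR (- F) * _ = (a * b) * (expR (- F) * q)); last by ring.
rewrite (_ : expR F * _ = (a * b) * (expR F * q)); last by ring.
rewrite (_ : b * q' * a = (a * b) * q'); last by ring.
rewrite !(ler_pM2l ab) q1 andbT.
by rewrite expRN ler_pdivrMl ?expR_gt0.
Qed.

(* The product D(h e^f) D(h e^-f) is the Laplace transform of X - X', with X' an
   independent copy of X, up to normalisation. Conditioning on one point x replaces h by
   [shift_weight h x], and by [hankel_det_tilt] the conditioned Laplace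
   transform of X stays within a factor e^(2F) of the unconditioned one. *)
Lemma laplace_symmetrized n h f F : measurable_fun setT f ->
  (forall x, `|f x| <= F) -> weight h ->
  hankel_det n (tilt h f) * hankel_det n (tilt h (fun x => - f x)) <=
  expR (16 * F ^+ 2 * n%:R) * hankel_det n h ^+ 2.
Proof.
move=> fm fF; elim: n h => [|n IH] h hw.
  have d1 g : hankel_det 0 g = 1 by exact: det_mx00.
  by rewrite !d1 mulr0 expR0 expr1n.
set f' := fun x => - f x.
have fm' : measurable_fun setT f' by exact: measurable_funN.
have fF' x : `|f' x| <= F by rewrite normrN.
have tw := weight_tilt fm fF hw; have tw' := weight_tilt fm' fF' hw.
set K := expR (16 * F ^+ 2 * n%:R).
have K0 : 0 < K by exact: expR_gt0.
set d0 := hankel_det n.+1 h; set d1 := hankel_det n.+1 (tilt h f).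
set d2 := hankel_det n.+1 (tilt h f').
have d0p : 0 < d0 by exact: hankel_det_gt0.
have d1p : 0 < d1 by exact: hankel_det_gt0.
(* [l] is the unconditioned Laplace transform, and [Q] the value of [w + w^-1] at both ends of the
   range of the ratio [w] below. *)
pose l := d1 / d0; have lp : 0 < l by rewrite divr_gt0.
pose Q : R := expR (2 * F) + (expR (2 * F))^-1.
(* Pointwise form of the induction step: the two terms are at most [h x * D] times [w] and [w^-1],
   the second one by the induction hypothesis. *)
have pw x : l^-1 * (tilt h f x * hankel_det n (shift_weight (tilt h f) x)) +
    l / K * (tilt h f' x * hankel_det n (shift_weight (tilt h f') x)) <=
    Q * (h x * hankel_det n (shift_weight h x)).
  have sw := weight_shift x hw.
  have := IH _ sw; rewrite -!shift_tilt -/K -/f'.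
  have /andP[] := hankel_det_tilt n x fm fF hw.
  have := hankel_det_gt0 n sw.
  have := hankel_det_gt0 n (weight_shift x tw).
  rewrite -/d0 -/d1 -/f'.
  set a := hankel_det n (shift_weight (tilt h f) x).
  set b := hankel_det n (shift_weight (tilt h f') x).
  set D := hankel_det n (shift_weight h x) => a0 D0 lo hi ab.
  (* Conditioned over unconditioned transform, with the contribution [expR (f x)] of the fixed
     particle. This contribution and [hankel_det_tilt] each cost a factor [expR F], hence the
     [2 * F]. *)
  pose w := expR (f x) * a / (l * D).
  have lD : 0 < l * D by rewrite mulr_gt0.
  have w0 : 0 < w by rewrite divr_gt0// mulr_gt0 ?expR_gt0.
  have fx := fF x; rewrite ler_norml in fx; move/andP: fx => [fx1 fx2].
  have aE : a = (a * d0) / d0 by rewrite mulfK// gt_eqF.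
  have w_lo : (expR (2 * F))^-1 <= w.
    rewrite /w ler_pdivlMr// -expRN (_ : - (2 * F) = - F + - F); last by ring.
    have lDe : 0 <= expR (- F) * (l * D) by rewrite mulr_ge0 ?expR_ge0 ?(ltW lD).
    rewrite expRD -mulrA ler_pM ?ler_expR ?expR_ge0 ?lDe//.
    rewrite aE ler_pdivlMr// (le_trans _ lo)// /l le_eqVlt; apply/orP; left; apply/eqP.
    by field; rewrite gt_eqF.
  have w_hi : w <= expR (2 * F).
    rewrite /w ler_pdivrMr// (_ : 2 * F = F + F); last by ring.
    rewrite expRD -mulrA ler_pM ?ler_expR ?expR_ge0 ?(ltW a0)//.
    rewrite aE ler_pdivrMr// (le_trans hi)// /l le_eqVlt; apply/orP; left; apply/eqP.
    by field; rewrite gt_eqF.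
  have wQ : w + w^-1 <= Q by apply: addV_le => //; exact: expR_gt0.
  have -> : Q * (h x * D) = h x * (D * Q) by ring.
  apply: (@le_trans _ _ (h x * (D * (w + w^-1)))); last first.
    by rewrite ler_wpM2l ?weight_ge0// ler_pM2l.
  rewrite (_ : l^-1 * _ = h x * (D * w)); last first.
    by rewrite /w /tilt; field; rewrite !gt_eqF.
  rewrite mulrDr mulrDr lerD2l.
  rewrite (_ : _ * (tilt h f' x * b) = h x * (l / K * expR (- f x) * b)); last first.
    by rewrite /tilt /f'; ring.
  rewrite ler_wpM2l ?weight_ge0// /w expRN.
  have e0 := expR_gt0 (f x).
  rewrite (_ : D / _ = l / K * (expR (f x))^-1 * (K * D ^+ 2 / a)); last first.
    by field; rewrite !gt_eqF.
  rewrite ler_pM2l ?mulr_gt0 ?invr_gt0//.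
  rewrite (ler_pdivlMr _ _ a0) [b * a]mulrC. exact: ab.
have [i1 r1] := hankel_det_rec n tw; have [i2 r2] := hankel_det_rec n tw'.
have [i0 r0] := hankel_det_rec n hw.
have iZ c g : mu.-integrable setT (EFin \o g) ->
  mu.-integrable setT (EFin \o (fun x => c * g x)).
  by move=> ig; have := integrableZl measurableT c ig.
have j1 := iZ l^-1 _ i1; have j2 := iZ (l / K) _ i2.
have : \int[mu]_x (l^-1 * (tilt h f x * hankel_det n (shift_weight (tilt h f) x)) +
    l / K * (tilt h f' x * hankel_det n (shift_weight (tilt h f') x))) <=
    \int[mu]_x (Q * (h x * hankel_det n (shift_weight h x))).
  apply: le_Rintegral => //; last exact: iZ.
  by have := integrableD measurableT j1 j2.
have -> : \int[mu]_x (Q * (h x * hankel_det n (shift_weight h x))) =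
    Q * (n.+1%:R * d0) by rewrite (RintegralZl _ measurableT i0) r0.
have -> : \int[mu]_x (l^-1 * (tilt h f x * hankel_det n (shift_weight (tilt h f) x)) +
    l / K * (tilt h f' x * hankel_det n (shift_weight (tilt h f') x))) =
    l^-1 * (n.+1%:R * d1) + l / K * (n.+1%:R * d2).
  rewrite (RintegralD measurableT j1 j2); congr (_ + _).
    by rewrite (RintegralZl _ measurableT i1) r1.
  by rewrite (RintegralZl _ measurableT i2) r2.
have n0 : 0 < n.+1%:R :> R by rewrite ltr0n.
(* By the choice of [l] the first term is exactly [d0]. Moving it to the right leaves the factor
   [Q - 1 = 1 + O(F^2)], which makes the exponent quadratic in [F]. *)
rewrite (_ : _ + _ = n.+1%:R * (d0 + l / K * d2)); last first.
  by rewrite /l; field; rewrite !gt_eqF.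
rewrite mulrCA ler_pM2l// => H.
(* The constant is [16 = 4 * 2^2], from [expR_addN_le] at [2 * F]. *)
have QF : Q - 1 <= expR (16 * F ^+ 2).
  have := expR_addN_le (2 * F); rewrite expRN -/Q.
  by rewrite (_ : 4 * _ = 16 * F ^+ 2)//; ring.
rewrite -[n.+1%:R]natr1 mulrDr mulr1 expRD -/K.
have -> : d1 * d2 = K * d0 * (l / K * d2) by rewrite /l; field; rewrite !gt_eqF.
have -> : K * expR (16 * F ^+ 2) * d0 ^+ 2 = K * d0 * (expR (16 * F ^+ 2) * d0) by ring.
rewrite ler_pM2l ?mulr_gt0//.
apply: (@le_trans _ _ ((Q - 1) * d0)); last by rewrite ler_pM2r.
by rewrite mulrBl mul1r lerBrDl.
Qed.

End weights.

(** * Positivity of the constant weight when the support is infinite *)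

Section infinite_support.
Variables (R : realType) (mu : probability (measurableTypeR R) R).

Lemma infinite_not_root (A : set R) (p : {poly R}) :
  infinite_set A -> p != 0 -> exists2 x, A x & ~~ root p x.
Proof.
move=> /(@infinite_set_fset R _ (size p))[B BA sB] p0.
have := max_poly_roots p0 _ (fset_uniq B); rewrite ltnNge sB => /contraFF/(_ erefl).
move=> /negbT/allPn[x xB px]; exists x => //; exact: BA.
Qed.

(** Some support point [x0] is not a root of [p]. The open set where [p^2] exceeds half of its value
    at [x0] contains [x0], so it has positive mass. *)
Lemma weight_cst1 : finite_moments mu -> infinite_set (msupport mu) ->
  weight mu (fun=> 1).
Proof.
move=> fm isupp.
have i1 : integrable_moments mu (fun=> 1).
  by move=> k; under eq_fun do rewrite mul1r; exact: fm.
split => // p p0.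
have [x0 sx0 px0] := infinite_not_root isupp p0.
have c0 : 0 < p.[x0] ^+ 2 / 2 by rewrite divr_gt0// exprn_even_gt0.
pose U : set (measurableTypeR R) := [set y | p.[x0] ^+ 2 / 2 < p.[y] ^+ 2].
have oU : open (U : set R).
  apply: (@open_comp _ _ (fun y : R => p.[y] ^+ 2) [set z | p.[x0] ^+ 2 / 2 < z]).
    move=> y _; under eq_fun do rewrite -horner_exp; exact: continuous_horner.
  exact: open_gt.
have mU : measurable U by exact: open_measurable.
have U0 : (0 < mu U)%E by apply: sx0 => //; rewrite /U/= ltr_pdivrMr// mulr2n; lra.
have ip := integrable_horner_sqr p i1.
rewrite -lte_fin /Rintegral fineK ?integrable_fin_num//.
apply: (@lt_le_trans _ _ (\int[mu]_x ((p.[x0] ^+ 2 / 2)%:E * (\1_U x)%:E))%E).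
  have iU : (\int[mu]_x (\1_U x)%:E = mu U)%E by rewrite integral_indic// setIT.
  rewrite ge0_integralZl_EFin ?(ltW c0)//; last first.
    by apply/measurable_EFinP; exact: measurable_indic.
  by rewrite iU; apply: mule_gt0; rewrite ?lte_fin.
apply: ge0_le_integral => //.
- by move=> x _; rewrite mule_ge0// lee_fin ltW.
- by apply/measurable_EFinP; apply: measurable_funM.
- exact: measurable_int ip.
- move=> x _; rewrite mul1r -EFinM lee_fin indicE.
  have [xU|_] := boolP (x \in U); rewrite ?mulr1 ?mulr0 ?sqr_ge0//.
  by have /ltW := set_mem xU.
Qed.

End infinite_support.

(** * Heine's formula for the integral of the squared Vandermonde product *)

Section vandermonde_integral.
Variables (R : realType) (mu : probability (measurableTypeR R) R).
Local Notation RM := (measurableTypeR R).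

Definition tensor n (h : RM -> R) (l : n.-tuple RM) : R := \prod_(j < n) h (tnth l j).

Lemma measurable_tensor n h : measurable_fun setT h -> measurable_fun setT (@tensor n h).
Proof.
move=> mh; apply: measurable_prod => j _; apply: measurableT_comp => //.
exact: measurable_tnth.
Qed.

(** The Vandermonde factors involving the first particle are exactly those that [shift_weight] puts
    on the others. *)
Lemma tensor_vandermonde_cons n h x (l : n.-tuple RM) :
  tensor h (tuple_cons (x, l)) * vandermonde_sq (tuple_cons (x, l)) =
  h x * (tensor (shift_weight h x) l * vandermonde_sq l).
Proof.
rewrite /tensor /vandermonde_sq !big_ord_recl.
rewrite [X in _ * (X * _)]big1 ?mul1r; last by move=> i; rewrite ltn0.
rewrite -mulrA tnth0; congr (_ * _).
under eq_bigr do rewrite tnthS.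
rewrite -!big_split; apply: eq_bigr => i _ /=.
rewrite big_mkcond big_ord_recl /= [in RHS]big_mkcond /= mulrA tnthS tnth0.
by congr (_ * _); apply: eq_bigr => j _; rewrite tnthS.
Qed.

(** Induction by Tonelli: with the first particle fixed, the inner integral is the case of a shifted
    weight, and [hankel_det_rec] supplies the factor [n.+1] of the factorial. *)
Lemma integral_tensor_vandermonde n h : weight mu h ->
  (\int[product_power mu n]_l (tensor h l * vandermonde_sq l)%:E =
   (n`!%:R * hankel_det mu n h)%:E)%E.
Proof.
have mTV m g : measurable_fun setT g ->
    measurable_fun setT (fun l : m.-tuple RM => (tensor g l * vandermonde_sq l)%:E).
  move=> mg; apply/measurable_EFinP; apply: measurable_funM.
    exact: measurable_tensor.
  exact: measurable_vandermonde_sq.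
have TV0 m g (l : m.-tuple RM) : (forall x, 0 <= g x) ->
    (0 <= (tensor g l * vandermonde_sq l)%:E)%E.
  by move=> g0; rewrite lee_fin mulr_ge0 ?vandermonde_sq_ge0// prodr_ge0.
elim: n h => [|n IH] h hw.
  rewrite /product_power integral_dirac//; last by apply: mTV; exact: (weight_meas hw).
  rewrite diracT mul1e /tensor /vandermonde_sq.
  by rewrite !big_ord0 /hankel_det det_mx00 mulr1.
have mTV' := mTV n.+1 _ (weight_meas hw).
rewrite (_ : product_power mu n.+1 =
  distribution (mu \x product_power mu n)%E (@tuple_cons _ RM n))//.
rewrite ge0_integral_distribution//; last first.
  by move=> l; apply: TV0; exact: (weight_ge0 hw).
rewrite fubini_tonelli1//=; last 2 first.
  by apply: measurableT_comp => //; exact: measurable_tuple_cons.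
  by move=> l /=; apply: TV0; exact: (weight_ge0 hw).
have [i1 r1] := hankel_det_rec n hw.
transitivity (\int[mu]_x (n`!%:R * (h x * hankel_det mu n (shift_weight h x)))%:E)%E.
  apply: eq_integral => x _; rewrite /fubini_F.
  under eq_integral do rewrite /= tensor_vandermonde_cons EFinM.
  have sw := weight_shift x hw.
  rewrite ge0_integralZl//.
  - by rewrite IH// -EFinM mulrCA.
  - by apply: mTV; exact: (weight_meas sw).
  - by move=> l _; apply: TV0; exact: (weight_ge0 sw).
  - by rewrite lee_fin; exact: (weight_ge0 hw).
under eq_integral do rewrite EFinM.
rewrite integralZl// -[X in (_ * X)%E]fineK ?integrable_fin_num//.
rewrite -/(Rintegral _ _ _) r1 -EFinM factS natrM; congr EFin; ring.
Qed.

End vandermonde_integral.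

(** * Integration against a measure given by a density *)

Section density_integral.
Local Open Scope ereal_scope.
Context d (T : measurableType d) (R : realType) (mu : {measure set T -> \bar R}).
Variables (f : T -> R) (mf : measurable_fun [set: T] f) (f0 : forall x, (0 <= f x)%R).
Import HBNNSimple.

Let nu := density_measure mu mf f0.

Lemma nnsfun_integral_density (g : {nnsfun T >-> R}) :
  \int[nu]_x (g x)%:E = \int[mu]_x ((g x)%:E * (f x)%:E).
Proof.
have mfE : measurable_fun setT (EFin \o f) by exact/measurable_EFinP.
rewrite integralT_nnsfun sintegralE.
have E x : (g x)%:E * (f x)%:E =
    \sum_(y \in range g) (y * \1_(g @^-1` [set y]) x)%:E * (f x)%:E.
  by rewrite {1}fimfunE -fsumEFin// ge0_mule_fsuml// => y; exact: nnfun_muleindic_ge0.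
under [RHS]eq_integral do rewrite E.
rewrite ge0_integral_fsum//; last 2 first.
- move=> y; apply: emeasurable_funM => //; apply/measurable_EFinP.
  by apply: measurable_funM => //; exact: measurable_indic.
- by move=> y x _; apply: mule_ge0; [exact: nnfun_muleindic_ge0|rewrite lee_fin].
apply: eq_fsbigr => y /set_mem[x _ <-].
rewrite [X in _ * X](_ : _ = \int[mu]_(z in g @^-1` [set g x]) (f z)%:E)//.
rewrite integral_mkcond -ge0_integralZl//.
- apply: eq_integral => z _; rewrite epatch_indic EFinM -muleA; congr (_ * _).
  exact: muleC.
- by apply: (measurable_restrictT _ _).1 => //; exact: measurable_funTS.
- by move=> z _; rewrite epatch_indic mule_ge0// lee_fin.
- by rewrite lee_fin.
Qed.

(** Monotone convergence along simple approximations of [g], on both sides. *)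
Lemma ge0_integral_density (g : T -> \bar R) :
  measurable_fun [set: T] g -> (forall x, 0 <= g x) ->
  \int[nu]_x g x = \int[mu]_x (g x * (f x)%:E).
Proof.
move=> mg g0; pose h := nnsfun_approx measurableT mg.
have hg x : EFin \o h ^~ x @ \oo --> g x.
  by apply: cvg_nnsfun_approx => // y _; exact: g0.
have nd x a b : (a <= b)%N -> (h a x)%:E <= (h b x)%:E.
  by move=> ab; rewrite lee_fin; exact/lefP/nd_nnsfun_approx.
transitivity (limn (fun n => \int[nu]_x (h n x)%:E)).
  rewrite -monotone_convergence//=.
  - by apply: eq_integral => x _; apply/esym/cvg_lim => //; exact: hg.
  - by move=> n; exact/measurable_EFinP.
  - by move=> n x _; rewrite lee_fin.
  - by move=> x _ a b; exact: nd.
under eq_fun do rewrite nnsfun_integral_density.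
rewrite -monotone_convergence//=.
- apply: eq_integral => x _; apply/cvg_lim => //.
  by apply: cvgeZr => //; exact: hg.
- by move=> n; apply: emeasurable_funM; exact/measurable_EFinP.
- by move=> n x _; rewrite mule_ge0// lee_fin.
- by move=> x _ a b ab; rewrite lee_wpmul2r ?nd// lee_fin.
Qed.

End density_integral.

(** * Integrals and Laplace transforms over the ensemble *)

Section ope_integral.
Variables (R : realType) (mu : probability (measurableTypeR R) R) (n : nat).
Local Notation RM := (measurableTypeR R).
Hypothesis w1 : weight mu (fun=> 1).

Definition additive_statistic (f : RM -> R) (l : n.-tuple RM) : R :=
  \sum_(j < n) f (tnth l j).

Lemma ge0_integral_ope (g : n.-tuple RM -> \bar R) :
  measurable_fun setT g -> (forall l, 0 <= g l)%E ->
  (\int[ope mu n]_l g l = ((n`!%:R * hankel_det mu n (fun=> 1))^-1)%:E *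
    \int[product_power mu n]_l (g l * (vandermonde_sq l)%:E))%E.
Proof.
move=> mg g0; set Z := n`!%:R * _.
have Z0 : 0 < Z by rewrite mulr_gt0 ?ltr0n ?fact_gt0// hankel_det_gt0.
have Zi0 : 0 <= Z^-1 by rewrite invr_ge0 ltW.
pose nu : {measure set (n.-tuple RM) -> \bar R} :=
  density_measure (product_power mu n) (@measurable_vandermonde_sq R n)
    (@vandermonde_sq_ge0 R n).
have nuT : nu setT = Z%:E.
  rewrite -(integral_tensor_vandermonde n w1); apply: eq_integral => l _.
  by rewrite /tensor big1// mul1r.
rewrite -(ge0_integral_density _ (@measurable_vandermonde_sq R n) (@vandermonde_sq_ge0 R n))//.
rewrite -[Z^-1]/((NngNum Zi0)%:num) -ge0_integral_mscale//.
apply: eq_measure_integral => A mA _.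
change (mnormalize nu (product_power mu n) A = (Z^-1)%:E * nu A)%E.
(* The total mass is neither 0 nor infinite, so [mnormalize] does divide by it instead of returning
   its default. *)
by rewrite /mnormalize nuT eqe gt_eqF// muleC.
Qed.

Lemma measurable_additive_statistic (f : RM -> R) : measurable_fun setT f ->
  measurable_fun setT (additive_statistic f).
Proof.
move=> mf; apply: measurable_sum => j; apply: measurableT_comp => //.
exact: measurable_tnth.
Qed.

Lemma le_additive_statistic (f : RM -> R) F l : (forall x, `|f x| <= F) ->
  `|additive_statistic f l| <= n%:R * F.
Proof.
move=> fF; apply: (le_trans (ler_norm_sum _ _ _)).
apply: (@le_trans _ _ (\sum_(j < n) F)); first exact: ler_sum.
by rewrite sumr_const card_ord mulr_natl.
Qed.

(** The exponential of a sum is a product over particles, so Heine's formula applies to the tilted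
    weight; the factorials cancel. *)
Lemma ope_laplace (f : RM -> R) F : measurable_fun setT f -> (forall x, `|f x| <= F) ->
  (\int[ope mu n]_l (expR (additive_statistic f l))%:E =
  (hankel_det mu n (tilt (fun=> 1) f) / hankel_det mu n (fun=> 1))%:E)%E.
Proof.
move=> mf fF; have tw := weight_tilt mf fF w1.
rewrite ge0_integral_ope; last 2 first.
- apply/measurable_EFinP; apply: measurableT_comp => //.
  exact: measurable_additive_statistic.
- by move=> l; rewrite lee_fin expR_ge0.
rewrite (_ : (\int[_]_l _)%E = (n`!%:R * hankel_det mu n (tilt (fun=> 1) f))%:E).
  rewrite -EFinM invfM mulrACA mulVf ?mul1r; last by rewrite pnatr_eq0 -lt0n fact_gt0.
  by rewrite mulrC.
rewrite -(integral_tensor_vandermonde n tw); apply: eq_integral => l _.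
rewrite -EFinM /tensor /additive_statistic expR_sum.
by congr ((_ * _)%:E); apply: eq_bigr => j _; rewrite /tilt mul1r.
Qed.

End ope_integral.

(** * Jensen's inequality for the exponential of a bounded variable *)

Section jensen.
Context d (T : measurableType d) (R : realType) (P : probability T R).

Lemma bounded_integrable (Y : T -> R) B : measurable_fun setT Y ->
  (forall x, `|Y x| <= B) -> P.-integrable setT (EFin \o Y).
Proof.
move=> mY YB; apply: (@le_integrable _ _ _ P _ measurableT _ (EFin \o cst B)).
- exact/measurable_EFinP.
- by move=> x _ /=; rewrite lee_fin (le_trans (YB x))// ler_norm.
- exact: finite_measure_integrable_cst.
Qed.

(** Integrate the tangent line bound [expR m * (1 + Y - m) <= expR Y] at the mean [m]. *)
Lemma expR_expectation_le (Y : T -> R) B : measurable_fun setT Y ->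
  (forall x, `|Y x| <= B) ->
  ((expR (fine 'E_P[Y]))%:E <= \int[P]_x (expR (Y x))%:E)%E.
Proof.
move=> mY YB; have iY := bounded_integrable mY YB.
rewrite unlock; set m := fine _.
have mE : (\int[P]_x (Y x)%:E = m%:E)%E by rewrite fineK// integrable_fin_num.
have ic (c : R) : P.-integrable setT (EFin \o cst c).
  exact: finite_measure_integrable_cst.
have i1 : P.-integrable setT (fun x => ((1 - m)%:E + (Y x)%:E)%E).
  by apply: integrableD => //; exact: ic.
have i2 : P.-integrable setT (fun x => ((expR m)%:E * ((1 - m)%:E + (Y x)%:E))%E).
  exact: integrableZl.
have -> : (expR m)%:E = (\int[P]_x ((expR m)%:E * ((1 - m)%:E + (Y x)%:E)))%E.
  rewrite integralZl// integralD//; last exact: ic.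
  by rewrite integral_cst//= probability_setT mule1 mE -EFinD subrK mule1.
apply: le_integral => //.
  apply: (@bounded_integrable _ (expR B)); first by apply: measurableT_comp.
  move=> x; rewrite ger0_norm ?expR_ge0// ler_expR (le_trans _ (YB x))//.
  exact: ler_norm.
move=> x _; rewrite -EFinD -EFinM lee_fin.
rewrite -[in leRHS](subrKC m (Y x)) expRD ler_wpM2l ?expR_ge0//.
by rewrite -addrA [- m + _]addrC; exact: expR_ge1Dx.
Qed.

End jensen.

(** * Sub-Gaussian tails of additive statistics *)

Section tail.
Variables (R : realType) (mu : probability (measurableTypeR R) R) (n : nat).
Local Notation RM := (measurableTypeR R).
Hypothesis w1 : weight mu (fun=> 1).

Lemma additive_statisticZ (f : RM -> R) c (l : n.-tuple RM) :
  additive_statistic (fun x => c * f x) l = c * additive_statistic f l.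
Proof. by rewrite /additive_statistic mulr_sumr. Qed.

Lemma expectation_additive_statisticZ (f : RM -> R) F c : measurable_fun setT f ->
  (forall x, `|f x| <= F) ->
  fine 'E_(ope mu n)[additive_statistic (fun x => c * f x)] =
  c * fine 'E_(ope mu n)[additive_statistic f].
Proof.
move=> mf fF; rewrite unlock.
have iS : (ope mu n).-integrable setT (EFin \o @additive_statistic R n f).
  apply: bounded_integrable; first exact: measurable_additive_statistic.
  by move=> l; exact: le_additive_statistic.
under eq_integral do rewrite additive_statisticZ EFinM.
by rewrite integralZl// fineM// integrable_fin_num.
Qed.

Lemma ope_upper_tail (f : RM -> R) (F s t : R) : measurable_fun setT f ->
  (forall x, `|f x| <= F) -> 0 < t ->
  (ope mu n [set l | (s + fine 'E_(ope mu n)[additive_statistic f] <=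
                     additive_statistic f l)%R]
   <= (expR (- (t * s) + 16 * (t * F) ^+ 2 * n%:R))%:E)%E.
Proof.
move=> mf fF t0; set m := fine _.
have tfm : measurable_fun setT (fun x => t * f x) by exact: measurable_funM.
have tfF x : `|t * f x| <= t * F by rewrite normrM gtr0_norm// ler_pM2l.
have ntfm : measurable_fun setT (fun x => - t * f x) by exact: measurable_funM.
have ntfF x : `|- t * f x| <= t * F by rewrite mulNr normrN.
have lap := laplace_symmetrized n tfm tfF w1.
have lap1 := ope_laplace n w1 tfm tfF.
have lap2 := ope_laplace n w1 ntfm ntfF.
have jen := expR_expectation_le (ope mu n)
  (@measurable_additive_statistic _ n _ ntfm) (fun l => le_additive_statistic l ntfF).
rewrite lap2 lee_fin (expectation_additive_statisticZ _ mf fF) -/m in jen.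
pose S : {RV (ope mu n) >-> R} := HB.pack (@additive_statistic R n f)
  (isMeasurableFun.Build _ _ _ _ _ (@measurable_additive_statistic _ n _ mf)).
apply: (le_trans (chernoff S (s + m) t0)).
rewrite /mmt_gen_fun unlock.
rewrite (eq_integral (fun l : n.-tuple RM =>
  (expR (additive_statistic (fun x => t * f x) l))%:E)); last first.
  by move=> l _; rewrite additive_statisticZ /= mulrC.
rewrite lap1 -EFinM lee_fin.
set d0 := hankel_det _ _ (fun=> 1) in jen lap *.
have d00 : 0 < d0 by exact: hankel_det_gt0.
set d1 := hankel_det _ _ _ in lap *.
have d10 : 0 < d1 by apply: hankel_det_gt0; exact: weight_tilt tfF w1.
rewrite (_ : (fun x => - (t * f x)) = (fun x => - t * f x)) in lap; last first.
  by apply/funext => x; rewrite mulNr.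
set d2 := hankel_det _ _ _ in jen lap *.
rewrite mulrDr opprD expRD expRD mulrCA ler_pM2l ?expR_gt0//.
rewrite -mulNr.
(* By Jensen, [expR (- t * m)] is at most the transform [d2 / d0] at [- t]; the product of the two
   transforms is then bounded by [laplace_symmetrized]. *)
apply: (@le_trans _ _ (d1 / d0 * (d2 / d0))).
  have d10' : 0 < d1 / d0 by exact: divr_gt0.
  by rewrite (ler_pM2l d10').
by rewrite mulrACA -invfM -expr2 ler_pdivrMr ?exprn_gt0.
Qed.

Lemma ope_two_sided_tail (f : RM -> R) (F s : R) : measurable_fun setT f ->
  (forall x, `|f x| <= F) -> (0 < n)%N -> 0 < F -> 0 < s ->
  (ope mu n [set l | (s <= `|additive_statistic f l -
                         fine 'E_(ope mu n)[additive_statistic f]|)%R]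
   <= (2 * expR (- (s ^+ 2 / (64 * n%:R * F ^+ 2))))%:E)%E.
Proof.
move=> mf fF n0 F0 s0; set m := fine _.
have nR0 : 0 < n%:R :> R by rewrite ltr0n.
(* The minimizer of the exponent [- (t * s) + 16 * (t * F) ^+ 2 * n%:R]. *)
pose t := s / (32 * n%:R * F ^+ 2).
have t0 : 0 < t by rewrite divr_gt0// !mulr_gt0// exprn_gt0.
have e : - (t * s) + 16 * (t * F) ^+ 2 * n%:R = - (s ^+ 2 / (64 * n%:R * F ^+ 2)).
  by rewrite /t; field; rewrite !gt_eqF.
(* The lower tail of [f] is the upper tail of [-1 * f], which has the same bound [F]. *)
have nfm : measurable_fun setT (fun x => -1 * f x) by exact: measurable_funM.
have nfF x : `|-1 * f x| <= F by rewrite mulN1r normrN.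
have := ope_upper_tail s mf fF t0.
have := ope_upper_tail s nfm nfF t0.
rewrite (expectation_additive_statisticZ _ mf fF) e -/m.
set A2 := (X in ope mu n X); move=> hA2.
set A1 := (X in ope mu n X); move=> hA1.
have mS := @measurable_additive_statistic _ n _ mf.
have mA1 : measurable A1.
  by rewrite -[A1]setTI; apply: (measurable_fun_le measurableT _ mS); exact: measurable_cst.
have mA2 : measurable A2.
  rewrite -[A2]setTI; apply: (measurable_fun_le measurableT); first exact: measurable_cst.
  exact: measurable_additive_statistic.
set B := (X in ope mu n X).
have BE : B = A1 `|` A2.
  apply/seteqP; split => l; rewrite /B /A1 /A2/= additive_statisticZ.
    by rewrite ler_normr => /orP[?|?]; [left|right]; lra.
  by rewrite ler_normr => -[?|?]; apply/orP; [left|right]; lra.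
rewrite BE (le_trans (measureU2 _ mA1 mA2))//.
by rewrite mulr_natl mulr2n EFinD leeD.
Qed.

End tail.

(** * Concentration of scaled linear statistics around their mean *)

Theorem theorem1p2 (R : realType) :
  exists A : R, 0 < A /\
  forall (mu : probability (measurableTypeR R) R) (xstar alpha : R) (f : R -> R)
    (eps N : R) (n : nat),
    finite_moments mu ->
    infinite_set (msupport mu) ->
    0 < alpha ->
    measurable_fun [set: measurableTypeR R] (f : measurableTypeR R -> measurableTypeR R) ->
    bounded_fun f ->
    0 < eps ->
    N != 0 ->
    (0 < n)%N ->
    let X := @linear_statistic R f alpha xstar n in
    (ope mu n [set l | (eps <= N^-1 * `|X l - fine ('E_(ope mu n)[X])|)%R]
     <= (2 * expR (- (eps * Num.min (eps * N ^+ 2 / (8 * A * n%:R * sup_norm f ^+ 2))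
                                  (N / (6 * sup_norm f)))))%:E)%E.
Proof.
(* Then [8 * A = 64], the constant of [ope_two_sided_tail]. *)
exists 8; split => // mu xstar alpha f eps N n fm isupp _ mf bf eps0 N0 n0; cbv zeta.
set X := @linear_statistic R f alpha xstar n.
have w1 := weight_cst1 fm isupp.
(* Scaling and centring are absorbed into the test function, which keeps the bound [sup_norm f]. *)
pose g : measurableTypeR R -> R := fun y => f (n%:R `^ alpha * (y - xstar)).
have mg : measurable_fun setT g.
  apply: (measurableT_comp mf); apply: measurable_funM => //.
  exact: measurable_funB.
have XE : X = additive_statistic g by [].
have fF x : `|f x| <= sup_norm f.
  apply: ub_le_sup; last by exists x.
  (* [bounded_fun] provides bounds only strictly above [M], hence [M + 1]. *)
  have [M [_ fM]] := bf; exists (M + 1) => _ [y _ <-].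
  by apply: fM => //; rewrite ltrDl.
have gF x : `|g x| <= sup_norm f by exact: fF.
set F := sup_norm f in fF gF *.
have rhs0 (r : R) : (0 <= (2 * expR r)%:E)%E by rewrite lee_fin mulr_ge0 ?expR_ge0.
(* For negative [N] the event is empty, as its left-hand side is at most 0 and [eps] is positive. *)
have [Nneg|Npos] := ltP N 0.
  rewrite (_ : [set _ | _] = set0) ?measure0//.
  apply/seteqP; split => // l /= h.
  have : N^-1 * `|X l - fine 'E_(ope mu n)[X]| <= 0.
    by rewrite mulr_le0_ge0// invr_le0 ltW.
  lra.
have {}Npos : 0 < N by rewrite lt_neqAle eq_sym N0.
have F0 : 0 <= F by apply: le_trans (fF 0).
(* If [F = 0] the statistic vanishes and the event is again empty, so the divisions by 0 on the
   right are harmless. *)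
have [F0e|Fn0] := eqVneq F 0.
  have X0 : X = cst 0.
    apply/funext => l; apply/eqP; rewrite -normr_le0 XE.
    by have := le_additive_statistic l gF; rewrite F0e mulr0.
  rewrite (_ : [set _ | _] = set0) ?measure0//.
  apply/seteqP; split => // l /=; rewrite X0 expectation_cst/= subrr normr0 mulr0.
  lra.
have {}F0 : 0 < F by rewrite lt_neqAle eq_sym Fn0.
rewrite (_ : [set _ | _] = [set l | (eps * N <= `|additive_statistic g l -
    fine 'E_(ope mu n)[additive_statistic g]|)%R]); last first.
  by apply/seteqP; split => l /=; rewrite XE [N^-1 * _]mulrC ler_pdivlMr.
apply: (le_trans (ope_two_sided_tail w1 mg gF n0 F0 (mulr_gt0 eps0 Npos))).
rewrite lee_fin ler_pM2l// ler_expR lerN2.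
rewrite (_ : (eps * N) ^+ 2 / _ = eps * (eps * N ^+ 2 / (8 * 8 * n%:R * F ^+ 2))); last first.
  by field; rewrite !gt_eqF// ltr0n.
(* The minimum is at most its first argument, so the sub-Gaussian bound is already stronger. *)
by rewrite ler_pM2l// ge_min lexx.
Qed.
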